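(* Let $d=1$, $p\in\mathbb N$ ($p\ge1$), $n_{1,p}=2p+1$, and let the parameters $\{k_\ell\}_{\ell=1}^{2p+1}\subset\mathbb R$ be all different from one another. Let $K=K_x\times I_n$ be a space–time mesh element on which the real potential $V$ is constant, and let $$\phi_\ell(x,t)=\exp\big[i\big(k_\ell x-(k_\ell^2+V|_K)t\big)\big],\qquad\ell=1,\dots,2p+1,$$ be the basis of the discrete Trefftz space $\mathbb T_p(K)=\mathrm{span}\{\phi_1,\dots,\phi_{2p+1}\}$. Let $B\subset K$ be a two-dimensional ball such that $K$ is star-shaped with respect to $B$. Then for every $\psi\in\mathbf T(K)\cap H^{p+1}(K)$ there exists a vector-valued function $\mathbf a\in L^1(B)^{2p+1}$ such that $$D^{\boldsymbol j}\psi(z,s)=\sum_{\ell=1}^{2p+1}a_\ell(z,s)\,D^{\boldsymbol j}\phi_\ell(z,s)\quad\text{for all }|\boldsymbol j|\le p\text{ and a.e. }(z,s)\in B,$$ and $$\int_B\sum_{\ell=1}^{2p+1}|a_\ell(z,s)|\,\mathrm dV(z,s)\le C_\star\,|K|^{1/2}\,\|\psi\|_{H^{p+1}(K)},$$ where the constant $C_\star>0$ might depend on $p$ and $\{\phi_\ell\}$ but is independent of $K$ and $\psi$.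
   Context: $K_x\subset\mathbb R$ and $I_n\subset\mathbb R$ are bounded open intervals (space and time), $K=K_x\times I_n$, and $|K|$ is its Lebesgue measure. Functions are complex valued, and $$\mathbf T(K)=\{w\in H^1(I_n;L^2(K_x))\cap L^2(I_n;H^2(K_x)):\ i\partial_tw+\partial_x^2w-Vw=0\text{ on }K\}.$$ $H^{p+1}(K)$ is the space–time Sobolev space on $K$. For $\boldsymbol j=(j_x,j_t)\in\mathbb N_0^2$, $|\boldsymbol j|=j_x+j_t$ and $D^{\boldsymbol j}f=\partial_x^{j_x}\partial_t^{j_t}f$. The pointwise values $D^{\boldsymbol j}\psi(z,s)$, $|\boldsymbol j|\le p$, are those of the order-$p$ differential (Taylor polynomial) at $(z,s)$ of an $H^{p+1}(\mathbb R^2)$ extension of $\psi$, which exists for a.e. $(z,s)$; they agree a.e. with the weak derivatives of $\psi$. *)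

(* Defs.v *)
From mathcomp Require Import all_boot all_order all_algebra.
From mathcomp Require Import all_classical all_reals all_analysis.
From mathcomp Require Export complex.

Set Implicit Arguments.
Unset Strict Implicit.
Unset Printing Implicit Defensive.

Import Order.TTheory GRing.Theory Num.Theory.
Import numFieldNormedType.Exports.

Local Open Scope classical_set_scope.
Local Open Scope ring_scope.
Local Open Scope complex_scope.

(* A point of space-time is a pair (x, t); [leb2 R] is the area measure. *)
Notation leb2 R := (@lebesgue_measure R \x @lebesgue_measure R)%E.

Section Complex.
Variable R : realType.
Implicit Type z : R[i].

Definition cexp z : R[i] :=
  (expR (complex.Re z))%:C * (cos (complex.Im z) +i* sin (complex.Im z)).

End Complex.

Section Lebesgue.
Context d (T : measurableType d) (R : realType).
Variables (mu : {measure set T -> \bar R}) (D : set T).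
Implicit Type f : T -> R[i].

Definition cint f : R[i] :=
  Rintegral mu D (fun q => complex.Re (f q)) +i*
  Rintegral mu D (fun q => complex.Im (f q)).

Definition inL1 f : Prop :=
  mu.-integrable D (fun q => (complex.Re (f q))%:E) /\
  mu.-integrable D (fun q => (complex.Im (f q))%:E).

Definition L2normsq f : \bar R := (\int[mu]_(q in D) (Normc.normc (f q) ^+ 2)%:E)%E.

Definition inL2 f : Prop :=
  [/\ measurable_fun D (fun q => complex.Re (f q)),
      measurable_fun D (fun q => complex.Im (f q)) &
      (L2normsq f < +oo)%E].

End Lebesgue.

Section Derivatives.
Variable R : realType.
Implicit Types (g : R * R -> R) (f : R * R -> R[i]) (j : nat * nat).

Definition dx g : R * R -> R := fun q => derive1 (fun y => g (y, q.2)) q.1.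

Definition dt g : R * R -> R := fun q => derive1 (fun s => g (q.1, s)) q.2.

Definition mi_order j : nat := (j.1 + j.2)%N.

Definition Dreal j g : R * R -> R := iter j.1 dx (iter j.2 dt g).

(* D^j of a complex valued function: classical, componentwise. *)
Definition Dcl j f : R * R -> R[i] :=
  fun q => Dreal j (fun q' => complex.Re (f q')) q +i*
           Dreal j (fun q' => complex.Im (f q')) q.

(* Mixed partial derivative along a word; [true] stands for d/dx and [false]
   for d/dt. *)
Definition Dword (w : seq bool) g : R * R -> R :=
  foldr (fun b h => if b then dx h else dt h) g w.

(* C^infty(R^2): every mixed partial derivative is continuous and is again
   partially differentiable. *)
Definition smooth2 g : Prop := forall w : seq bool,
  continuous (Dword w g) /\
  forall q : R * R,
    derivable (fun y => Dword w g (y, q.2)) q.1 1 /\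
    derivable (fun s => Dword w g (q.1, s)) q.2 1.

Definition smooth1 (g : R -> R) : Prop :=
  forall (n : nat) (x : R), derivable (derive1n n g) x 1.

Definition compact_support_in (T : topologicalType) (D : set T) (g : T -> R)
    : Prop :=
  exists C : set T, [/\ compact C, C `<=` D & forall q, ~ C q -> g q = 0].

Definition test1 (D : set R) (g : R -> R) : Prop :=
  smooth1 g /\ compact_support_in D g.

Definition test2 (D : set (R * R)) g : Prop :=
  smooth2 g /\ compact_support_in D g.

End Derivatives.

(* Weak derivatives on an open set.  The defining identities are only used for
   functions in L^2 (almost every slice of which is in L^2 in the
   one-dimensional case), so all the integrals below converge. *)
Section WeakDerivatives.
Variable R : realType.

Definition is_wderiv1 (D : set R) (n : nat) (f g : R -> R[i]) : Prop :=
  forall chi : R -> R, test1 D chi ->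
    cint (@lebesgue_measure R) D (fun x => f x * (derive1n n chi x)%:C) =
    (-1) ^+ n * cint (@lebesgue_measure R) D (fun x => g x * (chi x)%:C).

Definition is_wderiv (D : set (R * R)) (j : nat * nat)
    (f g : R * R -> R[i]) : Prop :=
  forall chi : R * R -> R, test2 D chi ->
    cint (leb2 R) D (fun q => f q * (Dreal j chi q)%:C) =
    (-1) ^+ mi_order j * cint (leb2 R) D (fun q => g q * (chi q)%:C).

(* D^j f for f in a Sobolev space: some representative of the weak derivative,
   which is unique up to a null set (and junk if there is none in L^2).  When f
   is in H^(p+1) and |j| <= p it equals a.e. the coefficient of the order-p
   differential of an H^(p+1)(R^2) extension of f. *)
Definition wderiv (D : set (R * R)) (j : nat * nat) (f : R * R -> R[i])
    : R * R -> R[i] :=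
  xget (fun=> 0) [set g | inL2 (leb2 R) D g /\ is_wderiv D j f g].

Definition inH (m : nat) (D : set (R * R)) (f : R * R -> R[i]) : Prop :=
  inL2 (leb2 R) D f /\
  forall j, (mi_order j <= m)%N ->
    exists g, inL2 (leb2 R) D g /\ is_wderiv D j f g.

Definition Hnorm (m : nat) (D : set (R * R)) (f : R * R -> R[i]) : R :=
  Num.sqrt
    (\sum_(jx < m.+1) \sum_(jt < m.+1 |
        (mi_order (jx : nat, jt : nat) <= m)%N)
      fine (L2normsq (leb2 R) D (wderiv D (jx : nat, jt : nat) f))).

End WeakDerivatives.

(* Bochner spaces on Kx x In, with L^2(In; L^2(Kx)) identified with L^2(K). *)
Section Trefftz.
Variables (R : realType) (Kx In : set R).
Implicit Types w g : R * R -> R[i].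

(* g is the weak derivative of w : In -> L^2(Kx).  The Bochner integrals of
   w chi' and g chi are elements of L^2(Kx), hence the equality a.e. in x. *)
Definition is_bochner_dt w g : Prop :=
  forall chi : R -> R, test1 In chi ->
    {ae @lebesgue_measure R, forall x, Kx x ->
      cint (@lebesgue_measure R) In (fun t => w (x, t) * (derive1 chi t)%:C) =
      - cint (@lebesgue_measure R) In (fun t => g (x, t) * (chi t)%:C)}.

(* g(., t) is the n-th weak derivative of w(., t) for a.e. time t. *)
Definition is_slice_dx (n : nat) w g : Prop :=
  {ae @lebesgue_measure R, forall t, In t ->
    is_wderiv1 Kx n (fun x => w (x, t)) (fun x => g (x, t))}.

Definition inH1L2 w : Prop :=
  inL2 (leb2 R) (Kx `*` In) w /\
  exists g, inL2 (leb2 R) (Kx `*` In) g /\ is_bochner_dt w g.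

Definition inL2H2 w : Prop :=
  forall n : nat, (n <= 2)%N ->
    exists g, inL2 (leb2 R) (Kx `*` In) g /\ is_slice_dx n w g.

Definition trefftz (V : R * R -> R) w : Prop :=
  [/\ inH1L2 w, inL2H2 w &
      exists wt wxx : R * R -> R[i],
        [/\ inL2 (leb2 R) (Kx `*` In) wt /\ is_bochner_dt w wt,
            inL2 (leb2 R) (Kx `*` In) wxx /\ is_slice_dx 2 w wxx &
            {ae leb2 R, forall q, (Kx `*` In) q ->
              'i * wt q + wxx q - (V q)%:C * w q = 0}]].

End Trefftz.

Section Geometry.
Variable R : realType.

Definition disc (c : R * R) (r : R) : set (R * R) :=
  [set q | (q.1 - c.1) ^+ 2 + (q.2 - c.2) ^+ 2 < r ^+ 2].

Definition star_shaped_wrt (K B : set (R * R)) : Prop :=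
  forall b q : R * R, B b -> K q -> forall theta : R, 0 <= theta <= 1 ->
    K ((1 - theta) * b.1 + theta * q.1, (1 - theta) * b.2 + theta * q.2).

(* exp [i (kappa x - (kappa^2 + v) t)] *)
Definition plane_wave (v kappa : R) : R * R -> R[i] :=
  fun q => cexp ('i * (kappa * q.1 - (kappa ^+ 2 + v) * q.2)%:C).

End Geometry.

(* Main.v *)
Require Import Defs.
From mathcomp Require Import all_boot all_order all_algebra.
From mathcomp Require Import all_classical all_reals all_analysis.
From mathcomp Require Import measurable_realfun zify ring lra.

Set Implicit Arguments.
Unset Strict Implicit.
Unset Printing Implicit Defensive.

Import Order.TTheory GRing.Theory Num.Theory.
Import numFieldNormedType.Exports.

Local Open Scope classical_set_scope.
Local Open Scope ring_scope.

(** The proof avoids the Taylor polynomials of an extension of psi: it works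
    with the weak derivatives of psi of order at most p and inverts, at almost
    every point, the linear system that the coefficients have to solve.

    The equation  i d_t psi + d_x^2 psi - v psi = 0  may be differentiated, which
    gives, almost everywhere on K and whenever jx + 2 + jt <= p,

      D^(jx+2,jt) psi = - i D^(jx,jt+1) psi + v D^(jx,jt) psi

    ([wderiv_schroedinger]).  Only derivatives of order at most p occur, so the
    jet of psi at a point is determined by its 2p+1 entries (0,0), (1,0),
    (0,1), (1,1), ..., (0,p) with at most one derivative in x ([jet_unique],
    [chain]).  The jets of the plane waves obey the same recursion
    ([symbol_rec]), since D^j phi_l = s_j(k_l) phi_l with
    s_j(k) = (i k)^jx (- i (k^2 + v))^jt.  Along the chain s_j runs through
    polynomials in k of degrees 0, 1, ..., 2p, one of each degree; hence the
    matrix of the s_j(k_l) is a triangular matrix times the Vandermonde matrix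
    of the distinct k_l, and is invertible ([symbol_mx_unit]).  Its inverse N
    depends on p, v and the k_l only.  So

      a_l = phi_l^(-1) sum_m N_(l,m) D^(chain m) psi

    represents the whole jet of psi, and as |phi_l| = 1 the Cauchy-Schwarz
    inequality bounds the integral of sum_l |a_l| by a multiple of
    |K|^(1/2) times the L^2 norms of derivatives of psi
    ([integral_combination_le]).

    The analytic work is the recursion.  The hypotheses on psi state its time
    derivative through test functions of t, for almost every x, and its second
    space derivative slice by slice.  These two forms meet when the
    test function is a product a(x) b(t), where Fubini applies
    ([bochner_dt_tensor], [slice_dx_tensor]); the weak derivatives of psi are
    tested with such products as well.  What remains is that an integrable
    function that is orthogonal to all products of test functions vanishes
    almost everywhere ([tensor_fundamental]): smooth bumps built from exp(-1/x)
    converge to the indicators of intervals, so the integrals over all boxes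
    vanish, and a Dynkin argument in each variable reaches all measurable
    sets. *)

(** * Smooth functions built from exp(-1/x) *)

Section Flat.
Variable R : realType.
Implicit Types (P : {poly R}) (f g : R -> R) (x y : R).

(** The functions P(1/x) exp(-1/x), continued by 0, form a family that is
    stable under differentiation; this is what makes exp(-1/x) smooth at 0. *)
Definition flat P x : R :=
  if 0 < x then P.[x^-1] * expR (- x^-1) else 0.

(** Because y^n exp(-y) <= n! for y >= 0. *)
Lemma flat_bounded P : exists C : R, forall x, `|flat P x| <= C.
Proof.
have pow n y : 0 <= y -> y ^+ n * expR (- y) <= n`!%:R.
  move=> y0; rewrite expRN ler_pdivrMr ?expR_gt0//.
  case: n => [|n]; first by rewrite expr0 fact0 mul1r -(expR0 R) ler_expR.
  rewrite mulrC -ler_pdivrMr ?ltr0n ?fact_gt0//.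
  by apply: le_trans (expR_ge1Dxn n y0); rewrite lerDr.
exists (\sum_(i < size P) `|P`_i| * i`!%:R) => x; rewrite /flat.
case: ifPn => x0; last by rewrite normr0 sumr_ge0// => i _; rewrite mulr_ge0.
rewrite horner_coef mulr_suml; apply: le_trans (ler_norm_sum _ _ _) _.
apply: ler_sum => i _; rewrite -mulrA normrM ler_wpM2l//.
rewrite ger0_norm ?pow ?invr_ge0 ?(ltW x0)//.
by rewrite mulr_ge0 ?expR_ge0// exprn_ge0// invr_ge0 ltW.
Qed.

Lemma flatX2 P x : flat P x = x ^+ 2 * flat ('X^2 * P) x.
Proof.
rewrite /flat; case: ifPn => x0; last by rewrite mulr0.
by rewrite hornerM hornerXn; field; rewrite gt_eqF.
Qed.

Lemma is_derive_flat P x :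
  is_derive x 1 (flat P) (flat ('X^2 * (P - P^`())) x).
Proof.
have [x0|x0|->] := ltgtP x 0.
- rewrite /flat ltNge (ltW x0)/=.
  apply: (@near_eq_is_derive _ _ _ (cst 0)).
  near=> y; rewrite /= ltNge (_ : y <= 0)//.
  by apply: ltW; near: y; exact: lt_nbhsl.
- rewrite {2}/flat x0.
  apply: (@near_eq_is_derive _ _ _
    ((horner P \o GRing.inv) * (expR \o (-%R \o GRing.inv)))).
    near=> y; rewrite /flat (_ : 0 < y)//.
    by near: y; exact: lt_nbhsr.
  have dV : is_derive x 1 (GRing.inv : R -> R) (- x ^- 2 *: 1).
    by apply: (@is_deriveV R id) => //; rewrite gt_eqF.
  apply: is_derive_eq.
  rewrite /= !hornerE /GRing.scale /= -exprVn; ring.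
(* at the origin [flatX2] makes the difference quotient y times a bounded
   function *)
rewrite /flat ltxx; apply/is_derive1_caratheodory.
exists (fun y => y * flat ('X^2 * P) y); split; last by rewrite mul0r.
  by move=> y; rewrite ltxx !subr0 -/(flat P y) flatX2 expr2; ring.
have [C hC] := flat_bounded ('X^2 * P).
have C1 : 0 < C + 1.
  by rewrite (le_lt_trans (le_trans (normr_ge0 _) (hC 0)))// ltrDl.
suff : y * flat ('X^2 * P) y @[y --> (0 : R)] --> (0 : R).
  by rewrite /prop_for /continuous_at mul0r.
apply/cvgrPdist_le => e e0.
near=> y; rewrite sub0r normrN normrM.
have ye : `|y| <= e / (C + 1).
  near: y; have d0 : 0 < e / (C + 1) by rewrite divr_gt0.
  apply/nbhs_ballP; exists (e / (C + 1)) => //= z.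
  by rewrite /ball/= sub0r normrN => /ltW.
rewrite -(divfK (lt0r_neq0 C1) e); apply: ler_pM => //.
by rewrite (le_trans (hC _))// lerDl.
Unshelve. all: by end_near. Qed.

(** An algebra that contains the dilated flat functions and is stable under
    differentiation, so that all its members are smooth. *)
Inductive flat_algebra : (R -> R) -> Prop :=
| flat_cst c : flat_algebra (fun=> c)
| flat_affine P a b : flat_algebra (fun x => flat P (a * x + b))
| flat_add f g : flat_algebra f -> flat_algebra g -> flat_algebra (f + g)
| flat_mul f g : flat_algebra f -> flat_algebra g -> flat_algebra (f * g).

Lemma flat_algebra_derive f : flat_algebra f ->
  exists2 f', flat_algebra f' & forall x, is_derive x 1 f (f' x).
Proof.
elim=> [c|P a b|g h _ [g' Ag dg] _ [h' Ah dh]|g h Ag [g' Ag' dg] Ah [h' Ah' dh]].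
- by exists (fun=> 0); [exact: flat_cst|move=> x; exact: is_derive_cst].
- exists ((fun=> a) * (fun x => flat ('X^2 * (P - P^`())) (a * x + b))).
    by apply: flat_mul; [exact: flat_cst|exact: flat_affine].
  move=> x.
  have da : is_derive x 1 (fun x : R => a * x + b) a.
    have := is_deriveD (is_deriveZ a (is_derive_id x 1)) (is_derive_cst b x 1).
    by rewrite addr0 /GRing.scale /= mulr1.
  by have := @is_derive1_comp R (flat P) (fun x => a * x + b) x _ _
    (is_derive_flat P _) da; rewrite mulrC.
- by exists (g' + h'); [exact: flat_add|move=> x; exact: is_deriveD].
- exists (g * h' + h * g').
    by apply: flat_add; exact: flat_mul.
  by move=> x; exact: is_deriveM.
Qed.

Lemma flat_algebra_smooth f : flat_algebra f -> smooth1 f.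
Proof.
move=> Af n; have : flat_algebra (derive1n n f).
  elim: n => //= n /flat_algebra_derive[f' Af' df].
  rewrite (_ : (derive1n n f)^`()%classic = f')//.
  by apply/funext => x; rewrite derive1E; case: (df x).
by move=> /flat_algebra_derive[f' _ df] x; case: (df x).
Qed.

(** The shift by 1 makes the support a compact subset of the open interval; it
    exhausts the interval as n grows. *)
Definition bump (alpha beta : R) (n : nat) x : R :=
  flat 1 (n.+1%:R * (x - alpha) - 1) * flat 1 (n.+1%:R * (beta - x) - 1).

Lemma flat1_itv x : 0 <= flat 1 x <= 1.
Proof.
rewrite /flat; case: ifPn => x0; last by rewrite lexx ler01.
by rewrite hornerC mul1r expR_ge0 expR_le1 oppr_le0 invr_ge0 ltW.
Qed.

Lemma bump_itv alpha beta n x : 0 <= bump alpha beta n x <= 1.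
Proof.
have /andP[a0 a1] := flat1_itv (n.+1%:R * (x - alpha) - 1).
have /andP[b0 b1] := flat1_itv (n.+1%:R * (beta - x) - 1).
by rewrite /bump mulr_ge0// mulr_ile1.
Qed.

Lemma bump_smooth alpha beta n : smooth1 (bump alpha beta n).
Proof.
apply: flat_algebra_smooth.
rewrite (_ : bump _ _ _ =
   (fun x => flat 1 (n.+1%:R * x + (- (n.+1%:R * alpha) - 1))) *
   (fun x => flat 1 (- n.+1%:R * x + (n.+1%:R * beta - 1)))).
  by apply: flat_mul; exact: flat_affine.
by apply/funext => x; rewrite /bump; congr (flat _ _ * flat _ _); ring.
Qed.

Lemma bump_out alpha beta n x :
  ~~ (alpha + n.+1%:R^-1 <= x <= beta - n.+1%:R^-1) -> bump alpha beta n x = 0.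
Proof.
have inv_le y : (n.+1%:R^-1 <= y) = (1 <= n.+1%:R * y).
  by rewrite -[X in X <= _]mul1r ler_pdivrMr// mulrC.
rewrite lerBrDr -!lerBrDl !inv_le.
rewrite /bump /flat !subr_gt0 => xab.
case: ifP => ax; case: ifP => xb; rewrite ?mul0r ?mulr0//.
by move: xab; rewrite !ltW.
Qed.

Lemma bump_test1 alpha beta n : test1 `]alpha, beta[%classic (bump alpha beta n).
Proof.
split; first exact: bump_smooth.
exists `[alpha + n.+1%:R^-1, beta - n.+1%:R^-1]%classic.
have n0 : 0 < n.+1%:R^-1 :> R by rewrite invr_gt0.
split; first exact: segment_compact.
  move=> x; rewrite /= !in_itv/= => /andP[ax xb].
  by rewrite (lt_le_trans _ ax) ?ltrDl// (le_lt_trans xb)// gtrBl.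
by move=> x; rewrite /= in_itv /= => /negP; exact: bump_out.
Qed.

Lemma bump_cvg alpha beta x :
  bump alpha beta ^~ x @ \oo --> (\1_(`]alpha, beta[%classic) x : R).
Proof.
have flat1_cvg (y : R) : 0 < y ->
    flat 1 (n.+1%:R * y - 1) @[n --> \oo] --> (1 : R).
  move=> y0; have zoo : (n.+1%:R * y - 1 : R) @[n --> \oo] --> +oo.
    apply/cvgryPge => A; near=> n.
    rewrite lerBrDr -ler_pdivrMr//; near: n.
    exists (Num.truncn `|(A + 1) / y|) => // n /= An.
    apply: le_trans (ler_norm _) _; apply: ltW.
    by apply: lt_le_trans (truncnS_gt _) _; rewrite ler_nat.
  apply: cvg_trans (_ : expR (- (n.+1%:R * y - 1)^-1) @[n --> \oo] --> _).
    apply: near_eq_cvg; near=> n; rewrite /flat hornerC mul1r.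
    rewrite (_ : 0 < _)//; near: n.
    by move/cvgryPgt : zoo; apply.
  rewrite -[X in _ --> X](expR0 R).
  apply: continuous_cvg; [exact: continuous_expR|].
  rewrite -[X in _ --> X]oppr0; apply: cvgN; apply/gtr0_cvgV0; last exact: zoo.
  by move/cvgryPgt : zoo; apply.
rewrite indicE; have [|] := boolP (x \in _).
  rewrite inE/= in_itv/= => /andP[ax xb].
  rewrite -[X in _ --> X](mul1r 1).
  by apply: cvgM; apply: flat1_cvg; rewrite subr_gt0.
move=> xab; rewrite (_ : (fun n => _) = cst 0); first exact: cvg_cst.
apply/funext => n; apply: bump_out; apply: contra xab => /andP[ax xb].
have n0 : 0 < n.+1%:R^-1 :> R by rewrite invr_gt0.
rewrite inE/= in_itv/= (lt_le_trans _ ax) ?ltrDl// (le_lt_trans xb)//.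
by rewrite gtrBl.
Unshelve. all: by end_near. Qed.

End Flat.

(** * Tensor products of test functions *)

Section Tensor.
Variable R : realType.
Implicit Types (f g : R -> R) (D : set R).

Lemma smooth1_derive1 f : smooth1 f -> smooth1 (f^`()%classic).
Proof.
by move=> sf n x; have := sf n.+1 x; rewrite /derive1n iterSr.
Qed.

Lemma smooth1_continuous f : smooth1 f -> continuous f.
Proof.
by move=> sf x; apply/differentiable_continuous/derivable1_diffP/(sf 0%N).
Qed.

Lemma test1_derive1 D f : test1 D f -> test1 D (f^`()%classic).
Proof.
move=> [sf [C [cC CD fC]]]; split; first exact: smooth1_derive1.
exists C; split => // x Cx; rewrite derive1E.
rewrite (@near_eq_derive _ _ _ _ (cst 0)) ?derive_cst//.
have : nbhs x (~` C).
  apply: open_nbhs_nbhs; split => //; apply: closed_openC.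
  by apply: compact_closed => //; exact: Rhausdorff.
by apply: filterS => y Cy; rewrite fC.
Qed.

Lemma test1_derive1n n D f : test1 D f -> test1 D (derive1n n f).
Proof. by move=> tf; elim: n => //= n; exact: test1_derive1. Qed.

Lemma test1_continuous D f : test1 D f -> continuous f.
Proof. by case=> sf _; exact: smooth1_continuous. Qed.

Lemma test1_bounded D f : test1 D f -> exists M : R, forall x, `|f x| <= M.
Proof.
move=> tf; have cf := test1_continuous tf; case: tf => _ [C [cC CD fC]].
have : compact (f @` C).
  by apply: continuous_compact => //; exact: continuous_subspaceT.
move=> /compact_bounded[M [_ hM]]; exists (`|M| + 1) => x.
have [Cx|nCx] := pselect (C x); last by rewrite fC// normr0 addr_ge0.
by apply: hM; [rewrite (le_lt_trans (ler_norm M))// ltrDl|exists x].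
Qed.

Definition tensor f g : R * R -> R := fun q => f q.1 * g q.2.

Lemma Dword_tensor f g w : smooth1 f -> smooth1 g ->
  Dword w (tensor f g) =
  tensor (derive1n (count id w) f) (derive1n (count negb w) g).
Proof.
move=> sf sg; elim: w => //= b w ->; apply/funext => q; case: b => /=.
  rewrite add0n /dx /tensor /= derive1Mr//; exact: sf.
rewrite add0n /dt /tensor /= derive1Ml//; exact: sg.
Qed.

Lemma Dreal_tensor f g j : smooth1 f -> smooth1 g ->
  Dreal j (tensor f g) = tensor (derive1n j.1 f) (derive1n j.2 g).
Proof.
move=> sf sg.
have -> : Dreal j (tensor f g) =
    Dword (nseq j.1 true ++ nseq j.2 false) (tensor f g).
  by rewrite /Dreal; elim: j.1 => [|n /= ->]//; elim: j.2 => [|n /= ->].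
by rewrite Dword_tensor// !count_cat !count_nseq/= !mul1n !mul0n addn0.
Qed.

Lemma smooth2_tensor f g : smooth1 f -> smooth1 g -> smooth2 (tensor f g).
Proof.
move=> sf sg w; rewrite Dword_tensor//.
set a := derive1n _ f; set b := derive1n _ g.
have da x : derivable a x 1 by exact: sf.
have db x : derivable b x 1 by exact: sg.
split=> [q|q].
  apply: cvgM.
    apply: (@continuous_comp _ _ _ fst a); first exact: cvg_fst.
    exact/differentiable_continuous/derivable1_diffP/da.
  apply: (@continuous_comp _ _ _ snd b); first exact: cvg_snd.
  exact/differentiable_continuous/derivable1_diffP/db.
split.
  by apply: (@derivableM _ _ a (cst (b q.2))); [exact: da|exact: derivable_cst].
by apply: (@derivableM _ _ (cst (a q.1)) b); [exact: derivable_cst|exact: db].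
Qed.

Lemma test2_tensor D D' f g : test1 D f -> test1 D' g ->
  test2 (D `*` D') (tensor f g).
Proof.
move=> [sf [C [cC CD fC]]] [sg [C' [cC' CD' gC]]].
split; first exact: smooth2_tensor.
exists (C `*` C'); split; first exact: compact_setX.
  by move=> q [/CD ? /CD' ?].
move=> q /not_andP[Cq|Cq]; rewrite /tensor; first by rewrite fC// mul0r.
by rewrite gC// mulr0.
Qed.

End Tensor.

(** * The fundamental lemma for tensor products of test functions *)

Section Dynkin.
Context d d' (T : measurableType d) (S : measurableType d') (R : realType).
Variable mu : {measure set T -> \bar R}.
Local Open Scope ereal_scope.

(** The sets on which the integral vanishes form a Dynkin system; the map [u]
    allows one coordinate of a product to be treated at a time. *)
Lemma integral_preimage_eq0 (D : set T) (h : T -> \bar R) (u : T -> S)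
    (G : set (set S)) :
  measurable D -> measurable_fun setT u ->
  measurable = <<s G >> -> setI_closed G ->
  mu.-integrable D h -> \int[mu]_(x in D) h x = 0 ->
  (forall A, G A -> \int[mu]_(x in D `&` u @^-1` A) h x = 0) ->
  forall A, measurable A -> \int[mu]_(x in D `&` u @^-1` A) h x = 0.
Proof.
move=> mD mfu mG GI ih h0 hG A mA.
have mDu B : measurable B -> measurable (D `&` u @^-1` B).
  move=> mB; apply: measurableI => //.
  by rewrite -[X in measurable X]setTI; exact: mfu.
have iDu B : measurable B -> mu.-integrable (D `&` u @^-1` B) h.
  by move=> mB; apply: (integrableS mD (mDu _ mB)) => //; exact: subIsetl.
move: A mA; rewrite [X in forall A, X A -> _]mG.
apply: (dynkin_induction mG GI) => //.
- by rewrite preimage_setT setIT.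
- move=> B mB hB; move: h0.
  rewrite -[X in integral _ X _](setIT D) -(setUv (u @^-1` B)) setIUr.
  rewrite integral_setU//.
  + by rewrite hB add0e.
  + exact: mDu.
  + by apply: (mDu (~` B)); exact: measurableC.
  + rewrite -setIUr setUv setIT; exact: (measurable_int _ ih).
  + by apply/disj_setPS => x [[_ /= uB] [_ /= nuB]].
- move=> F mF tF hF; rewrite preimage_bigcup setI_bigcupr integral_bigcup.
  + by rewrite eseries0// => i _ _; exact: hF.
  + apply/trivIsetP => i j _ _ ij.
    move/trivIsetP : tF => /(_ i j Logic.I Logic.I ij) FF.
    by rewrite setIACA setIid -preimage_setI FF preimage_set0 setI0.
  + by move=> k; exact: mDu.
  + rewrite -setI_bigcupr -preimage_bigcup; apply: iDu.
    exact: bigcupT_measurable.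
Qed.

End Dynkin.

Section Fundamental.
Variable R : realType.
Implicit Types f g : R -> R.

Local Notation RM := (measurableTypeR R).

Definition box (x0 x1 t0 t1 : R) : set (RM * RM) :=
  `]x0, x1[%classic `*` `]t0, t1[%classic.

Lemma measurable_box x0 x1 t0 t1 : measurable (box x0 x1 t0 t1).
Proof. by apply: measurableX; exact: measurable_itv. Qed.

Lemma measurable_tensor (D : set (RM * RM)) f g : measurable_fun setT (f : RM -> R) ->
  measurable_fun setT (g : RM -> R) -> measurable_fun D (tensor f g : RM * RM -> R).
Proof.
move=> mf mg; apply/measurable_funTS; apply: measurable_funM.
  exact: (measurableT_comp mf measurable_fst).
exact: (measurableT_comp mg measurable_snd).
Qed.

Section Box.
Variables (x0 x1 t0 t1 : R) (G : RM * RM -> R).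
Let K := box x0 x1 t0 t1.
Let Kx : set RM := `]x0, x1[%classic.
Let In : set RM := `]t0, t1[%classic.
Hypothesis iG : (leb2 R).-integrable K (EFin \o G).
Hypothesis G_tensor : forall f g, test1 Kx f -> test1 In g ->
  (\int[leb2 R]_(q in K) (G q * tensor f g q)%:E = 0)%E.

Let mK : measurable K. Proof. exact: measurable_box. Qed.

Let mG : measurable_fun K G.
Proof. by have /measurable_int/measurable_EFinP := iG. Qed.

(** Dominated convergence along bumps that tend to the indicator of the
    smaller box. *)
Let integral_subbox a b c e : x0 <= a -> b <= x1 -> t0 <= c -> e <= t1 ->
  (\int[leb2 R]_(q in K `&` box a b c e) (G q)%:E = 0)%E.
Proof.
move=> xa bx tc et.
have sub D (u0 u1 v0 v1 : R) : u0 <= v0 -> v1 <= u1 -> test1 `]v0, v1[%classic D ->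
    test1 `]u0, u1[%classic D.
  move=> uv vu [sD [C [cC CD D0]]]; split => //; exists C; split => //.
  apply: (subset_trans CD) => z; rewrite /= !in_itv/= => /andP[vz zv].
  by rewrite (le_lt_trans uv)//= (lt_le_trans zv).
pose h n q := G q * tensor (bump a b n) (bump c e n) q.
have h0 n : (\int[leb2 R]_(q in K) (h n q)%:E = 0)%E.
  by apply: G_tensor; [apply: (@sub _ _ _ a b)|apply: (@sub _ _ _ c e)] => //;
    exact: bump_test1.
rewrite integral_mkcondr.
have mbump a' b' n : measurable_fun setT (bump a' b' n : RM -> R).
  apply: continuous_measurable_fun; exact/smooth1_continuous/bump_smooth.
have bump_le (a' b' : R) n z : `|bump a' b' n z| <= 1.
  by have /andP[b0 b1] := bump_itv a' b' n z; rewrite ger0_norm.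
have [] := @dominated_convergence _ _ _ (leb2 R) K mK
  (fun n q => (h n q)%:E) ((fun q => (G q)%:E) \_ (box a b c e))
  (fun q => `|(G q)%:E|%E).
- move=> n; apply/measurable_EFinP; apply: measurable_funM => //.
  exact: measurable_tensor.
- apply/(measurable_restrict _ (measurable_box _ _ _ _) mK).
  by apply/measurable_EFinP; apply: (measurable_funS mK _ mG) => // q [].
- apply: aeW => q Kq; rewrite patchE.
  rewrite (_ : (if _ then _ else _) =
    (G q * (\1_(`]a, b[%classic) q.1 * \1_(`]c, e[%classic) q.2))%:E).
    apply: cvg_EFin; first by apply: nearW.
    apply: cvgMr; apply: cvgM; exact: bump_cvg.
  rewrite !indicE -natrM mulnb (_ : _ && _ = (q \in box a b c e)).
    by case: ifP; rewrite ?mulr1 ?mulr0.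
  by apply/andP/idP; rewrite !inE.
- exact: integrable_abse.
- apply: aeW => q n Kq; rewrite lee_fin normrM ler_piMr// normrM.
  by rewrite mulr_ile1.
move=> _ _; rewrite (_ : [sequence _]_n = cst 0%E); last exact/funext.
by move=> /cvg_lim; rewrite lim_cst// => <-.
Qed.

(** The integral of G vanishes on the quadrants ]a, +oo[ x ]c, +oo[, which meet
    K in boxes.  Three Dynkin arguments let first the x-side, then the t-side, be an
    arbitrary measurable set, and finally replace the rectangles by arbitrary
    sets of the product. *)
Lemma tensor_fundamental : {ae leb2 R, forall q, K q -> G q = 0}.
Proof.
suff H E : measurable E -> (\int[leb2 R]_(q in K `&` E) (G q)%:E = 0)%E.
  have : ae_eq (leb2 R) K (EFin \o G) (cst 0%E).
    apply: (integral_ae_eq mK iG (measurable_cst 0%E)) => E EK mE.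
    by rewrite integral0 -(H _ mE) (setIidr EK).
  by apply: filterS => q h Kq; apply: EFin_inj; exact: h.
have mfst : measurable_fun setT (@fst RM RM) by exact: measurable_fst.
have msnd : measurable_fun setT (@snd RM RM) by exact: measurable_snd.
have ray := RGenOInfty.measurableE R.
have rayI : setI_closed (@RGenOInfty.G R).
  move=> _ _ [x ->] [y ->]; exists (Num.max x y); apply/seteqP; split=> z /=;
    by rewrite !in_itv/= !andbT gt_max => /andP.
have mray (x : R) : measurable (`]x, +oo[%classic : set RM) by exact: measurable_itv.
have KrayE a c : K `&` snd @^-1` `]c, +oo[%classic `&` fst @^-1` `]a, +oo[%classic =
    K `&` box (Num.max x0 a) x1 (Num.max t0 c) t1.
  apply/seteqP; split=> -[x t] /=; rewrite /K /box /= !in_itv/= !andbT !gt_max.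
    by move=> [[[/andP[-> ->] /andP[-> ->]] ->] ->].
  by move=> [[xK tK] [/andP[/andP[_ ->] _] /andP[/andP[_ ->] _]]].
have KsndE c : K `&` snd @^-1` `]c, +oo[%classic =
    K `&` snd @^-1` `]c, +oo[%classic `&` fst @^-1` `]x0, +oo[%classic.
  rewrite -setIA [_ `&` fst @^-1` _]setIC setIA; congr (_ `&` _).
  apply/esym/setIidPl => -[x t] [/=]; rewrite !in_itv/= andbT.
  by move=> /andP[].
have KrectE A : K `&` fst @^-1` A =
    K `&` snd @^-1` `]t0, +oo[%classic `&` fst @^-1` A.
  congr (_ `&` _); apply/esym/setIidPl => -[x t] [/= _]; rewrite !in_itv/= andbT.
  by move=> /andP[].
have Kray c a :
    (\int[leb2 R]_(q in K `&` snd @^-1` `]c, +oo[%classic `&` fst @^-1` `]a, +oo[%classic)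
      (G q)%:E = 0)%E.
  by rewrite KrayE; apply: integral_subbox => //; rewrite le_max lexx.
have Kfst c A : measurable A ->
    (\int[leb2 R]_(q in K `&` snd @^-1` `]c, +oo[%classic `&` fst @^-1` A)
      (G q)%:E = 0)%E.
  move: A; apply: (integral_preimage_eq0 _ mfst ray rayI).
  - by apply: measurableI => //; rewrite -[X in measurable X]setTI; exact: msnd.
  - apply: (integrableS mK _ _ iG) => //.
    by apply: measurableI => //; rewrite -[X in measurable X]setTI; exact: msnd.
  - by rewrite KsndE.
  - by move=> _ [a ->].
have Krect A B : measurable A -> measurable B ->
    (\int[leb2 R]_(q in K `&` fst @^-1` A `&` snd @^-1` B) (G q)%:E = 0)%E.
  move=> mA; move: B; apply: (integral_preimage_eq0 _ msnd ray rayI).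
  - by apply: measurableI => //; rewrite -[X in measurable X]setTI; exact: mfst.
  - apply: (integrableS mK _ _ iG) => //.
    by apply: measurableI => //; rewrite -[X in measurable X]setTI; exact: mfst.
  - by rewrite KrectE Kfst.
  - by move=> _ [c ->]; rewrite setIAC Kfst.
move: E; apply: (@integral_preimage_eq0 _ _ _ _ _ _ K _ id _ _ _
  (measurable_prod_measurableType _ _)) => //.
- move=> _ _ [A mA [B mB <-]] [A' mA' [B' mB' <-]].
  rewrite -setXI; exists (A `&` A'); first exact: measurableI.
  by exists (B `&` B') => //; exact: measurableI.
- have := integral_subbox (lexx x0) (lexx x1) (lexx t0) (lexx t1).
  by rewrite setIid.
- move=> _ [A mA [B mB <-]]; rewrite preimage_id -(Krect _ _ mA mB).
  by rewrite -setIA.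
Qed.

End Box.
End Fundamental.

(** * Integrals of complex functions *)

Section ComplexIntegral.
Context d (T : measurableType d) (R : realType).
Variables (mu : {measure set T -> \bar R}) (D : set T).
Hypothesis mD : measurable D.
Implicit Types (f g : T -> R[i]) (r : T -> R).

Lemma eq_cint f g : (forall q, D q -> f q = g q) -> cint mu D f = cint mu D g.
Proof.
by move=> fg; congr (_ +i* _)%C; apply: eq_Rintegral => q /[!inE] Dq; rewrite fg.
Qed.

Let ReD (z w : R[i]) : complex.Re (z + w) = complex.Re z + complex.Re w.
Proof. by case: z w => [? ?] []. Qed.

Let ImD (z w : R[i]) : complex.Im (z + w) = complex.Im z + complex.Im w.
Proof. by case: z w => [? ?] []. Qed.

Lemma inL1D f g : inL1 mu D f -> inL1 mu D g -> inL1 mu D (fun q => f q + g q).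
Proof.
move=> [f1 f2] [g1 g2]; split.
  under [X in _.-integrable _ X]eq_fun do rewrite ReD EFinD.
  exact: integrableD.
under [X in _.-integrable _ X]eq_fun do rewrite ImD EFinD.
exact: integrableD.
Qed.

Lemma cintD f g : inL1 mu D f -> inL1 mu D g ->
  cint mu D (fun q => f q + g q) = cint mu D f + cint mu D g.
Proof.
move=> [f1 f2] [g1 g2]; apply/eqP; rewrite eq_complex ReD ImD /=.
apply/andP; split; apply/eqP; rewrite -RintegralD//.
  by apply: eq_Rintegral => q _; rewrite ReD.
by apply: eq_Rintegral => q _; rewrite ImD.
Qed.

Let ReZ (z w : R[i]) :
  complex.Re (z * w) = complex.Re z * complex.Re w - complex.Im z * complex.Im w.
Proof. by case: z w => [? ?] []. Qed.

Let ImZ (z w : R[i]) :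
  complex.Im (z * w) = complex.Re z * complex.Im w + complex.Im z * complex.Re w.
Proof. by case: z w => [? ?] []. Qed.

Lemma inL1Z (c : R[i]) f : inL1 mu D f -> inL1 mu D (fun q => c * f q).
Proof.
move=> [f1 f2]; split.
  under [X in _.-integrable _ X]eq_fun do rewrite ReZ EFinB !EFinM.
  by apply: integrableB => //; exact: integrableZl.
under [X in _.-integrable _ X]eq_fun do rewrite ImZ EFinD !EFinM.
by apply: integrableD => //; exact: integrableZl.
Qed.

Lemma cintZ (c : R[i]) f : inL1 mu D f ->
  cint mu D (fun q => c * f q) = c * cint mu D f.
Proof.
move=> [f1 f2]; apply/eqP; rewrite eq_complex ReZ ImZ /=.
have iZ (x : R) h : mu.-integrable D (EFin \o h) ->
    mu.-integrable D (EFin \o (fun q => x * h q)).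
  by move=> ih; apply: (eq_integrable mD _ (fun q => x%:E * (h q)%:E)%E) => //;
    exact: integrableZl.
apply/andP; split; apply/eqP; rewrite -!RintegralZl//.
  by rewrite -RintegralB//; [apply: eq_Rintegral => q _; rewrite ReZ|exact: iZ..].
by rewrite -RintegralD//; [apply: eq_Rintegral => q _; rewrite ImZ|exact: iZ..].
Qed.

Lemma inL1_mulr f r : measurable_fun D r -> (exists M, forall q, `|r q| <= M) ->
  inL1 mu D f -> inL1 mu D (fun q => f q * (r q)%:C%C).
Proof.
move=> mr [M rM] [f1 f2].
have br : [bounded r x | x in D].
  exists M; split; first exact: num_real.
  by move=> x /ltW Mx y _; exact: le_trans (rM y) Mx.
split.
  under [X in _.-integrable _ X]eq_fun do rewrite ReZ mulr0 subr0.
  exact: (integrableMl mD f1 mr br).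
under [X in _.-integrable _ X]eq_fun do rewrite ImZ mulr0 add0r.
exact: (integrableMl mD f2 mr br).
Qed.

Lemma cint_ae_eq f g : inL1 mu D f -> inL1 mu D g ->
  {ae mu, forall q, D q -> f q = g q} -> cint mu D f = cint mu D g.
Proof.
move=> [/measurable_int f1 /measurable_int f2] [/measurable_int g1 /measurable_int g2].
move=> fg; congr (_ +i* _)%C; rewrite /Rintegral; congr fine;
  by apply: ae_eq_integral => //; apply: filterS fg => q h Dq; rewrite h.
Qed.

End ComplexIntegral.

Section Slices.
Context d d' (X : measurableType d) (Y : measurableType d') (R : realType).
Variables (m1 : {sigma_finite_measure set X -> \bar R})
          (m2 : {sigma_finite_measure set Y -> \bar R}).
Variables (E : set X) (F : set Y).
Hypotheses (mE : measurable E) (mF : measurable F).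
Implicit Type H : X * Y -> R.

Let mEF : measurable (E `*` F). Proof. exact: measurableX. Qed.

Let patch_slice1 H x : E x ->
  (fun y => ((EFin \o H) \_ (E `*` F)) (x, y)) = (fun y => (H (x, y))%:E) \_ F.
Proof.
by move=> Ex; apply/funext => y; rewrite !patchE in_setX (mem_set Ex).
Qed.

Let patch_slice2 H y : F y ->
  (fun x => ((EFin \o H) \_ (E `*` F)) (x, y)) = (fun x => (H (x, y))%:E) \_ E.
Proof.
by move=> Fy; apply/funext => x; rewrite !patchE in_setX (mem_set Fy) andbT.
Qed.

Lemma integrable_slice1 H :
  (m1 \x m2)%E.-integrable (E `*` F) (EFin \o H) ->
  {ae m1, forall x, E x -> m2.-integrable F (fun y => (H (x, y))%:E)}.
Proof.
move=> /(integrable_mkcond _ mEF) /ae_integrable1; apply: filterS => x h Ex.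
by apply/(integrable_mkcond _ mF); rewrite -patch_slice1.
Qed.

Lemma integrable_slice2 H :
  (m1 \x m2)%E.-integrable (E `*` F) (EFin \o H) ->
  {ae m2, forall y, F y -> m1.-integrable E (fun x => (H (x, y))%:E)}.
Proof.
move=> /(integrable_mkcond _ mEF) /ae_integrable2; apply: filterS => y h Fy.
by apply/(integrable_mkcond _ mE); rewrite -patch_slice2.
Qed.

(** Fubini in the form in which the equation uses it: an identity between the
    integrals over almost every slice can be integrated. *)
Lemma Rintegral_slice1 H H' :
  (m1 \x m2)%E.-integrable (E `*` F) (EFin \o H) ->
  (m1 \x m2)%E.-integrable (E `*` F) (EFin \o H') ->
  {ae m1, forall x, E x -> Rintegral m2 F (fun y => H (x, y)) =
                           Rintegral m2 F (fun y => H' (x, y))} ->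
  Rintegral (m1 \x m2)%E (E `*` F) H = Rintegral (m1 \x m2)%E (E `*` F) H'.
Proof.
move=> iH iH' HH'; rewrite /Rintegral; congr fine.
have sH := integrable_slice1 iH; have sH' := integrable_slice1 iH'.
move: iH iH' => /(integrable_mkcond _ mEF) iH /(integrable_mkcond _ mEF) iH'.
rewrite integral_mkcond [RHS]integral_mkcond -(integral12_prod_meas1 iH).
rewrite -(integral12_prod_meas1 iH').
apply: ae_eq_integral; [exact: measurableT|exact: (measurable_fubini_F iH)|
  exact: (measurable_fubini_F iH')|].
apply: filterS3 sH sH' HH' => x sH sH' HH' _; rewrite /fubini_F.
have [Ex|nEx] := pselect (E x); last first.
  by apply: eq_integral => y _; rewrite !patchE in_setX (memNset nEx).
rewrite patch_slice1// patch_slice1// -integral_mkcond -[RHS]integral_mkcond.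
rewrite -[LHS](fineK (integrable_fin_num mF (sH Ex))).
rewrite -[RHS](fineK (integrable_fin_num mF (sH' Ex))).
by congr EFin; exact: HH'.
Qed.

Lemma Rintegral_slice2 H H' :
  (m1 \x m2)%E.-integrable (E `*` F) (EFin \o H) ->
  (m1 \x m2)%E.-integrable (E `*` F) (EFin \o H') ->
  {ae m2, forall y, F y -> Rintegral m1 E (fun x => H (x, y)) =
                           Rintegral m1 E (fun x => H' (x, y))} ->
  Rintegral (m1 \x m2)%E (E `*` F) H = Rintegral (m1 \x m2)%E (E `*` F) H'.
Proof.
move=> iH iH' HH'; rewrite /Rintegral; congr fine.
have sH := integrable_slice2 iH; have sH' := integrable_slice2 iH'.
move: iH iH' => /(integrable_mkcond _ mEF) iH /(integrable_mkcond _ mEF) iH'.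
rewrite integral_mkcond [RHS]integral_mkcond -(integral21_prod_meas1 iH).
rewrite -(integral21_prod_meas1 iH').
apply: ae_eq_integral; [exact: measurableT|exact: (measurable_fubini_G iH)|
  exact: (measurable_fubini_G iH')|].
apply: filterS3 sH sH' HH' => y sH sH' HH' _; rewrite /fubini_G.
have [Fy|nFy] := pselect (F y); last first.
  by apply: eq_integral => x _; rewrite !patchE in_setX (memNset nFy) andbF.
rewrite patch_slice2// patch_slice2// -integral_mkcond -[RHS]integral_mkcond.
rewrite -[LHS](fineK (integrable_fin_num mE (sH Fy))).
rewrite -[RHS](fineK (integrable_fin_num mE (sH' Fy))).
by congr EFin; exact: HH'.
Qed.

Lemma inL1_slice1 (h : X * Y -> R[i]) : inL1 (m1 \x m2)%E (E `*` F) h ->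
  {ae m1, forall x, E x -> inL1 m2 F (fun y => h (x, y))}.
Proof.
move=> [/integrable_slice1 h1 /integrable_slice1 h2].
by apply: filterS2 h1 h2 => x h1 h2 Ex; split; [exact: h1|exact: h2].
Qed.

Lemma inL1_slice2 (h : X * Y -> R[i]) : inL1 (m1 \x m2)%E (E `*` F) h ->
  {ae m2, forall y, F y -> inL1 m1 E (fun x => h (x, y))}.
Proof.
move=> [/integrable_slice2 h1 /integrable_slice2 h2].
by apply: filterS2 h1 h2 => y h1 h2 Fy; split; [exact: h1|exact: h2].
Qed.

Lemma cint_slice1 (h h' : X * Y -> R[i]) :
  inL1 (m1 \x m2)%E (E `*` F) h -> inL1 (m1 \x m2)%E (E `*` F) h' ->
  {ae m1, forall x, E x -> cint m2 F (fun y => h (x, y)) =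
                           cint m2 F (fun y => h' (x, y))} ->
  cint (m1 \x m2)%E (E `*` F) h = cint (m1 \x m2)%E (E `*` F) h'.
Proof.
move=> [h1 h2] [h1' h2'] hh'; congr (_ +i* _)%C;
  by apply: Rintegral_slice1 => //; apply: filterS hh' => x hh' /hh'[].
Qed.

Lemma cint_slice2 (h h' : X * Y -> R[i]) :
  inL1 (m1 \x m2)%E (E `*` F) h -> inL1 (m1 \x m2)%E (E `*` F) h' ->
  {ae m2, forall y, F y -> cint m1 E (fun x => h (x, y)) =
                           cint m1 E (fun x => h' (x, y))} ->
  cint (m1 \x m2)%E (E `*` F) h = cint (m1 \x m2)%E (E `*` F) h'.
Proof.
move=> [h1 h2] [h1' h2'] hh'; congr (_ +i* _)%C;
  by apply: Rintegral_slice2 => //; apply: filterS hh' => x hh' /hh'[].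
Qed.

End Slices.

(** * The Schroedinger relation between weak derivatives *)

Section SquareIntegrable.
Context d (T : measurableType d) (R : realType).
Variables (mu : {measure set T -> \bar R}) (D : set T).
Hypotheses (mD : measurable D) (finD : (mu D < +oo)%E).
Implicit Types f : T -> R[i].

Lemma sqr_normc (z : R[i]) :
  Normc.normc z ^+ 2 = complex.Re z ^+ 2 + complex.Im z ^+ 2.
Proof. by case: z => a b; rewrite /= sqr_sqrtr// addr_ge0// sqr_ge0. Qed.

Lemma measurable_normc f : measurable_fun D (fun q => complex.Re (f q)) ->
  measurable_fun D (fun q => complex.Im (f q)) ->
  measurable_fun D (fun q => Normc.normc (f q)).
Proof.
move=> m1 m2; rewrite (_ : (fun q => _) =
  Num.sqrt \o (fun q => complex.Re (f q) ^+ 2 + complex.Im (f q) ^+ 2)).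
  apply: (measurableT_comp (continuous_measurable_fun (@sqrt_continuous R))).
  by apply: measurable_funD; exact: measurable_funX.
by apply/funext => q /=; case: (f q).
Qed.

Lemma inL2_integrable_sqr f : inL2 mu D f ->
  mu.-integrable D (fun q => (Normc.normc (f q) ^+ 2)%:E).
Proof.
move=> [m1 m2 foo]; apply/integrableP; split.
  by apply/measurable_EFinP; apply: measurable_funX; exact: measurable_normc.
rewrite (le_lt_trans _ foo)// /L2normsq le_eqVlt; apply/orP; left; apply/eqP.
by apply: eq_integral => q _; rewrite gee0_abs// lee_fin sqr_ge0.
Qed.

(** On a set of finite measure, because |x| <= 1 + x^2. *)
Lemma inL2_inL1 f : inL2 mu D f -> inL1 mu D f.
Proof.
move=> Lf; have := inL2_integrable_sqr Lf; case: Lf => m1 m2 _ isqr.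
have i1 : mu.-integrable D (cst 1%:E).
  apply/integrableP; split; first exact: measurable_cst.
  under eq_integral do rewrite /= normr1.
  by rewrite integral_cst// mul1e.
have idom := integrableD mD i1 isqr.
have dom (x y : R) : 0 <= y -> x ^+ 2 <= y -> `|x| <= 1 + y.
  move=> y0 xy; have [x1|x1] := lerP `|x| 1; first by rewrite (le_trans x1)// lerDl.
  rewrite -real_normK ?num_real// in xy.
  by rewrite (le_trans _ (le_trans xy _)) ?lerDr// expr2 ler_peMl// ltW.
split; apply: (le_integrable mD _ _ idom); try exact/measurable_EFinP.
- move=> q _; rewrite /= lee_fin [leRHS]ger0_norm ?addr_ge0 ?sqr_ge0//.
  by apply: dom; rewrite ?sqr_ge0// sqr_normc lerDl sqr_ge0.
- move=> q _; rewrite /= lee_fin [leRHS]ger0_norm ?addr_ge0 ?sqr_ge0//.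
  by apply: dom; rewrite ?sqr_ge0// sqr_normc lerDr sqr_ge0.
Qed.

End SquareIntegrable.

Section ProductMeasure.
Variable R : realType.
Local Notation RM := (measurableTypeR R).
Let mu2 : {measure set (RM * RM) -> \bar R} := leb2 R.

Fact leb2_ae_filter : Filter (almost_everywhere (leb2 R)).
Proof. exact: (ae_filter_ringOfSetsType mu2). Qed.

Lemma leb2_boxE (x0 x1 t0 t1 : R) : x0 < x1 -> t0 < t1 ->
  leb2 R (box x0 x1 t0 t1) = ((x1 - x0) * (t1 - t0))%:E.
Proof.
move=> x01 t01; transitivity ((@lebesgue_measure R) `]x0, x1[%classic *
    (@lebesgue_measure R) `]t0, t1[%classic)%E.
  by apply: product_measure1E; exact: measurable_itv.
by rewrite !lebesgue_measure_itv/= !lte_fin x01 t01 -!EFinD -EFinM.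
Qed.

End ProductMeasure.

#[export] Hint Extern 0 (Filter (nbhs (almost_everywhere _))) =>
  (apply: leb2_ae_filter) : typeclass_instances.

Section Schroedinger.
Variables (R : realType) (x0 x1 t0 t1 : R).
Hypotheses (x01 : x0 < x1) (t01 : t0 < t1).
Let Kx : set R := `]x0, x1[%classic.
Let In : set R := `]t0, t1[%classic.
Let K : set (R * R) := Kx `*` In.
Local Notation lam := (@lebesgue_measure R).
Local Notation RM := (measurableTypeR R).
Implicit Types (w g : RM * RM -> R[i]) (a b : R -> R).

Let mK : measurable (K : set (RM * RM)). Proof. exact: measurable_box. Qed.

Let mKx : measurable (Kx : set RM). Proof. exact: measurable_itv. Qed.

Let mIn : measurable (In : set RM). Proof. exact: measurable_itv. Qed.

Let test1_measurable (D E : set R) a : test1 D a ->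
  measurable_fun (E : set RM) (a : RM -> R).
Proof.
move=> ta; apply: measurable_funTS; apply: continuous_measurable_fun.
exact: test1_continuous ta.
Qed.

Lemma tensor_bounded (D E : set R) a b : test1 D a -> test1 E b ->
  exists M, forall q, `|tensor a b q| <= M.
Proof.
move=> /test1_bounded[M hM] /test1_bounded[N hN]; exists (M * N) => q.
by rewrite normrM; exact: ler_pM.
Qed.

Lemma inL1_tensor (D E : set R) w a b : test1 D a -> test1 E b ->
  inL1 (leb2 R) K w -> inL1 (leb2 R) K (fun q => w q * (tensor a b q)%:C%C).
Proof.
move=> ta tb; apply: (inL1_mulr mK); last exact: tensor_bounded ta tb.
by apply: measurable_tensor; [exact: test1_measurable ta|
  exact: test1_measurable tb].
Qed.

(** On the slice at x the factor a(x) of the test function is a constant that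
    leaves the integral, so what remains is the defining identity of the time
    derivative for the single test function b. *)
Lemma bochner_dt_tensor w g a b : inL1 (leb2 R) K w -> inL1 (leb2 R) K g ->
  is_bochner_dt Kx In w g -> test1 Kx a -> test1 In b ->
  cint (leb2 R) K (fun q => w q * (tensor a (b^`()%classic) q)%:C%C) =
  - cint (leb2 R) K (fun q => g q * (tensor a b q)%:C%C).
Proof.
move=> Lw Lg wg ta tb; have tb' := test1_derive1 tb.
have Lgab := inL1_tensor ta tb Lg.
rewrite -mulN1r -(cintZ mK)//; apply: (cint_slice1 mKx mIn).
- exact: inL1_tensor ta tb' Lw.
- exact: inL1Z.
apply: filterS3 (inL1_slice1 mKx mIn Lw) (inL1_slice1 mKx mIn Lg) (wg b tb).
move=> x sw sg h Kxx.
have {}sw := sw Kxx; have {}sg := sg Kxx.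
have swb : inL1 lam In (fun t => w (x, t) * (b^`()%classic t)%:C%C).
  by apply: (inL1_mulr _ _ _ sw); [by []|exact: test1_measurable tb'|
    exact: test1_bounded tb'].
have sgb : inL1 lam In (fun t => g (x, t) * (b t)%:C%C).
  by apply: (inL1_mulr _ _ _ sg); [by []|exact: test1_measurable tb|
    exact: test1_bounded tb].
transitivity ((a x)%:C%C *
    cint lam In (fun t => w (x, t) * (b^`()%classic t)%:C%C)).
  rewrite -cintZ//; apply: eq_cint => t _.
  by rewrite /tensor /= rmorphM /= mulrCA.
rewrite h// mulrN -mulNr -cintZ//; apply: eq_cint => t _.
by rewrite /tensor /= rmorphM /= mulN1r mulNr mulrCA.
Qed.

Lemma slice_dx_tensor n w g a b : inL1 (leb2 R) K w -> inL1 (leb2 R) K g ->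
  is_slice_dx Kx In n w g -> test1 Kx a -> test1 In b ->
  cint (leb2 R) K (fun q => w q * (tensor (derive1n n a) b q)%:C%C) =
  (-1) ^+ n * cint (leb2 R) K (fun q => g q * (tensor a b q)%:C%C).
Proof.
move=> Lw Lg wg ta tb; have ta' := test1_derive1n n ta.
have Lgab := inL1_tensor ta tb Lg.
rewrite -(cintZ mK)//; apply: (cint_slice2 mKx mIn).
- exact: inL1_tensor ta' tb Lw.
- exact: inL1Z.
apply: filterS3 (inL1_slice2 mKx mIn Lw) (inL1_slice2 mKx mIn Lg) wg.
move=> t sw sg h Int.
have {}sw := sw Int; have {}sg := sg Int.
have swa : inL1 lam Kx (fun x => w (x, t) * (derive1n n a x)%:C%C).
  by apply: (inL1_mulr _ _ _ sw); [by []|exact: test1_measurable ta'|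
    exact: test1_bounded ta'].
have sga : inL1 lam Kx (fun x => g (x, t) * (a x)%:C%C).
  by apply: (inL1_mulr _ _ _ sg); [by []|exact: test1_measurable ta|
    exact: test1_bounded ta].
transitivity ((b t)%:C%C *
    cint lam Kx (fun x => w (x, t) * (derive1n n a x)%:C%C)).
  rewrite -cintZ//; apply: eq_cint => x _.
  by rewrite /tensor /= rmorphM /=; ring.
rewrite (h Int a ta) mulrA -cintZ//; apply: eq_cint => x _.
by rewrite /tensor /= rmorphM /=; ring.
Qed.

Lemma inL2_K_inL1 w : inL2 (leb2 R) K w -> inL1 (leb2 R) K w.
Proof. by apply: (inL2_inL1 mK); rewrite [X in (X < _)%E](leb2_boxE x01 t01) ltry. Qed.

Lemma cint_tensor_lin (c c' : R[i]) w g a b : test1 Kx a -> test1 In b ->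
  inL1 (leb2 R) K w -> inL1 (leb2 R) K g ->
  cint (leb2 R) K (fun q => (c * w q + c' * g q) * (tensor a b q)%:C%C) =
  c * cint (leb2 R) K (fun q => w q * (tensor a b q)%:C%C) +
  c' * cint (leb2 R) K (fun q => g q * (tensor a b q)%:C%C).
Proof.
move=> ta tb Lw Lg.
have Iw := inL1_tensor ta tb Lw; have Ig := inL1_tensor ta tb Lg.
rewrite -(cintZ mK c Iw) -(cintZ mK c' Ig) -(cintD mK).
- by apply: eq_cint => q _; rewrite mulrDl !mulrA.
- exact: (inL1Z mK).
- exact: (inL1Z mK).
Qed.

(** The equation of [trefftz] with both derivatives moved to a product of test
    functions. *)
Lemma trefftz_tensor (V : R * R -> R) (v : R) w a b :
  inL1 (leb2 R) K w -> (forall q, K q -> V q = v) -> trefftz Kx In V w ->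
  test1 Kx a -> test1 In b ->
  cint (leb2 R) K (fun q => w q * (tensor (derive1n 2 a) b q)%:C%C) =
  'i%C * cint (leb2 R) K (fun q => w q * (tensor a (b^`()%classic) q)%:C%C) +
  v%:C%C * cint (leb2 R) K (fun q => w q * (tensor a b q)%:C%C).
Proof.
move=> Lw Vv [_ _ [wt [wxx [[/inL2_K_inL1 Lt bt] [/inL2_K_inL1 Lxx sxx] eqn]]]].
move=> ta tb.
rewrite (slice_dx_tensor Lw Lxx sxx ta tb) (bochner_dt_tensor Lw Lt bt ta tb).
rewrite sqrrN expr1n mul1r mulrN -mulNr -cint_tensor_lin//.
apply: (cint_ae_eq mK); [exact: inL1_tensor ta tb Lxx| |].
  by apply: (inL1_tensor ta tb); apply: (inL1D mK); exact: (inL1Z mK).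
apply: filterS eqn => q eqn Kq; congr (_ * _); move: (eqn Kq); rewrite (Vv q Kq).
move=> e; transitivity ('i%C * wt q + wxx q - v%:C%C * w q +
  (- 'i%C * wt q + v%:C%C * w q)); first ring.
by rewrite e add0r.
Qed.

Lemma tensor_fundamental_complex g : inL1 (leb2 R) K g ->
  (forall a b, test1 Kx a -> test1 In b ->
    cint (leb2 R) K (fun q => g q * (tensor a b q)%:C%C) = 0) ->
  {ae leb2 R, forall q, K q -> g q = 0}.
Proof.
move=> Lg g0; have [g1 g2] := Lg.
have Re0 : {ae leb2 R, forall q, K q -> complex.Re (g q) = 0}.
  apply: tensor_fundamental => // a b ta tb.
  have [h _] := inL1_tensor ta tb Lg.
  have -> : (fun q => (complex.Re (g q) * tensor a b q)%:E) =
      (fun q => (complex.Re (g q * (tensor a b q)%:C%C))%:E).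
    by apply/funext => q; case: (g q) => x y /=; rewrite mulr0 subr0.
  rewrite -(fineK (integrable_fin_num mK h)); congr EFin.
  by have [] := g0 a b ta tb.
have Im0 : {ae leb2 R, forall q, K q -> complex.Im (g q) = 0}.
  apply: tensor_fundamental => // a b ta tb.
  have [_ h] := inL1_tensor ta tb Lg.
  have -> : (fun q => (complex.Im (g q) * tensor a b q)%:E) =
      (fun q => (complex.Im (g q * (tensor a b q)%:C%C))%:E).
    by apply/funext => q; case: (g q) => x y /=; rewrite mulr0 add0r.
  rewrite -(fineK (integrable_fin_num mK h)); congr EFin.
  by have [] := g0 a b ta tb.
apply: filterS2 Re0 Im0 => q r0 i0 Kq; move: (r0 Kq) (i0 Kq).
by case: (g q) => x y /= -> ->.
Qed.

Lemma wderiv_tensor j w g a b : is_wderiv K j w g -> test1 Kx a -> test1 In b ->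
  cint (leb2 R) K
    (fun q => w q * (tensor (derive1n j.1 a) (derive1n j.2 b) q)%:C%C) =
  (-1) ^+ mi_order j * cint (leb2 R) K (fun q => g q * (tensor a b q)%:C%C).
Proof.
move=> wg ta tb; rewrite -(wg _ (test2_tensor ta tb)).
by rewrite Dreal_tensor//; [case: ta|case: tb].
Qed.

(** The test functions a^(jx), b^(jt) turn the equation for w into the one for
    its derivative of order (jx, jt).  It is tested rather than
    differentiated, so no intermediate derivative of w has to exist. *)
Lemma wderiv_schroedinger (V : R * R -> R) (v : R) w jx jt gxx gt g :
  (forall q, K q -> V q = v) -> trefftz Kx In V w ->
  inL1 (leb2 R) K w -> inL1 (leb2 R) K gxx -> inL1 (leb2 R) K gt ->
  inL1 (leb2 R) K g ->
  is_wderiv K (jx.+2, jt) w gxx -> is_wderiv K (jx, jt.+1) w gt ->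
  is_wderiv K (jx, jt) w g ->
  {ae leb2 R, forall q, K q -> gxx q = - 'i%C * gt q + v%:C%C * g q}.
Proof.
move=> Vv Tw Lw Lxx Lt L wxx wt wg.
have Lr' : inL1 (leb2 R) K (fun q => 'i%C * gt q + - v%:C%C * g q).
  by apply: (inL1D mK); exact: (inL1Z mK).
have Lr : inL1 (leb2 R) K (fun q => 1 * gxx q + 1 * ('i%C * gt q + - v%:C%C * g q)).
  by apply: (inL1D mK); exact: (inL1Z mK).
have : {ae leb2 R, forall q, K q ->
    1 * gxx q + 1 * ('i%C * gt q + - v%:C%C * g q) = 0}.
  apply: (tensor_fundamental_complex Lr) => a b ta tb.
  rewrite !cint_tensor_lin//.
  set Xxx := cint _ _ _; set Xt := cint _ _ _; set X := cint _ _ _.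
  have := trefftz_tensor Lw Vv Tw (test1_derive1n jx ta) (test1_derive1n jt tb).
  rewrite (wderiv_tensor wxx ta tb : cint _ _ _ = _).
  rewrite (wderiv_tensor wt ta tb : cint _ _ _ = _).
  rewrite (wderiv_tensor wg ta tb : cint _ _ _ = _).
  rewrite -/Xxx -/Xt -/X /mi_order /= !addSn addnS !exprS.
  set s := (-1) ^+ _ => e.
  have ss : s * s = 1 by rewrite -expr2 sqrr_sign.
  rewrite !mul1r -[LHS]mul1r -ss; move/eqP: e; rewrite -subr_eq0 => /eqP e.
  by rewrite -[RHS](mulr0 s) -e; ring.
apply: filterS => q + Kq => /(_ Kq) /eqP.
by rewrite !mul1r addr_eq0 => /eqP ->; ring.
Qed.

End Schroedinger.

(** * Jets of plane waves *)

Section PlaneWaves.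
Variable R : realType.
Local Notation C := R[i].
Implicit Types (v kappa : R) (c : C) (q : R * R) (j : nat * nat).
Local Open Scope complex_scope.

(** The factor by which D^j multiplies a plane wave. *)
Definition symbol v kappa j : C :=
  ('i * kappa%:C) ^+ j.1 * (- 'i * (kappa ^+ 2 + v)%:C) ^+ j.2.

Lemma plane_waveE v kappa q : plane_wave v kappa q =
  cos (kappa * q.1 - (kappa ^+ 2 + v) * q.2) +i*
  sin (kappa * q.1 - (kappa ^+ 2 + v) * q.2).
Proof.
rewrite /plane_wave /cexp /= !mul0r mulr0 subrr mul1r add0r expR0.
by rewrite rmorph1 mul1r.
Qed.

Lemma normc_plane_wave v kappa q : Normc.normc (plane_wave v kappa q) = 1.
Proof. by rewrite plane_waveE /= cos2Dsin2 sqrtr1. Qed.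

Lemma plane_wave_neq0 v kappa q : plane_wave v kappa q != 0.
Proof.
apply/eqP => h; have := normc_plane_wave v kappa q.
by rewrite h Normc.normc0 => /eqP; rewrite eq_sym oner_eq0.
Qed.

Lemma derive1_wave c (alpha beta y : R) :
  derive1 (fun y => complex.Re
    (c * (cos (alpha * y + beta) +i* sin (alpha * y + beta)))) y =
  complex.Re (('i * alpha%:C) * c *
    (cos (alpha * y + beta) +i* sin (alpha * y + beta))).
Proof.
case: c => a b; set th := fun y => alpha * y + beta.
have dth : is_derive y 1 th alpha.
  have := is_deriveD (is_deriveZ alpha (is_derive_id y 1)) (is_derive_cst beta y 1).
  by rewrite addr0 /GRing.scale /= mulr1.
have dcos := @is_derive1_comp R cos th y _ _ (is_derive_cos _) dth.
have dsin := @is_derive1_comp R sin th y _ _ (is_derive_sin _) dth.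
have := is_deriveB (is_deriveZ a dcos) (is_deriveZ b dsin).
rewrite derive1E => d; rewrite (_ : (fun y => _) =
  a *: (cos \o th) - b *: (sin \o th)); last by apply/funext.
by rewrite (@derive_val _ _ _ _ _ _ _ d) /GRing.scale /= /th; ring.
Qed.

Lemma Dreal_plane_wave v kappa c j :
  Dreal j (fun q => complex.Re (c * plane_wave v kappa q)) =
  fun q => complex.Re (symbol v kappa j * c * plane_wave v kappa q).
Proof.
have dtE c' : dt (fun q => complex.Re (c' * plane_wave v kappa q)) =
    fun q => complex.Re (- 'i * (kappa ^+ 2 + v)%:C * c' * plane_wave v kappa q).
  apply/funext => q; rewrite /dt.
  under [X in derive1 X]eq_fun do rewrite plane_waveE /= addrC -mulNr.
  rewrite derive1_wave plane_waveE /= [kappa * _ - _]addrC -mulNr.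
  by congr complex.Re; congr (_ * _ * _); rewrite rmorphN mulrN mulNr.
have dxE c' : dx (fun q => complex.Re (c' * plane_wave v kappa q)) =
    fun q => complex.Re ('i * kappa%:C * c' * plane_wave v kappa q).
  apply/funext => q; rewrite /dx.
  under [X in derive1 X]eq_fun do rewrite plane_waveE /=.
  by rewrite derive1_wave plane_waveE.
have iterdt n : iter n (@dt R) (fun q => complex.Re (c * plane_wave v kappa q)) =
    fun q => complex.Re ((- 'i * (kappa ^+ 2 + v)%:C) ^+ n * c * plane_wave v kappa q).
  elim: n => [|n IH] /=; first by rewrite expr0 mul1r.
  by rewrite IH dtE; apply/funext => q; rewrite [_ ^+ n.+1]exprS !mulrA.
rewrite /Dreal iterdt /symbol; elim: j.1 => [|n IH] /=.
  by rewrite expr0 mul1r.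
by rewrite IH dxE; apply/funext => q; rewrite [_ ^+ n.+1]exprS !mulrA.
Qed.

Lemma Dcl_plane_wave v kappa j q :
  Dcl j (plane_wave v kappa) q = symbol v kappa j * plane_wave v kappa q.
Proof.
rewrite /Dcl.
have -> : (fun q => complex.Re (plane_wave v kappa q)) =
    (fun q => complex.Re (1 * plane_wave v kappa q)).
  by apply/funext => q'; rewrite mul1r.
have -> : (fun q => complex.Im (plane_wave v kappa q)) =
    (fun q => complex.Re (- 'i * plane_wave v kappa q)).
  apply/funext => q'; case: (plane_wave v kappa q') => x y /=; ring.
have ReIm (z : C) : complex.Re z +i* complex.Re (- 'i * z) = z.
  case: z => x y; apply/eqP; rewrite eq_complex /=.
  by apply/andP; split; apply/eqP; ring.
by rewrite !Dreal_plane_wave mulr1 (mulrC _ (- 'i)) -(mulrA (- 'i)) ReIm.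
Qed.

(** Schroedinger's equation on the level of symbols. *)
Lemma symbol_rec v kappa jx jt : symbol v kappa (jx.+2, jt) =
  - 'i * symbol v kappa (jx, jt.+1) + v%:C * symbol v kappa (jx, jt).
Proof.
rewrite /symbol /=; set a := 'i * kappa%:C; set b := - 'i * _.
rewrite [a ^+ jx.+2]exprS [a ^+ jx.+1]exprS [b ^+ jt.+1]exprS.
set s := a ^+ jx; set s' := b ^+ jt.
have i2 : 'i * 'i = -1 :> C.
  by apply/eqP; rewrite eq_complex /=; apply/andP; split; apply/eqP; ring.
have aa : a * a = - kappa%:C ^+ 2.
  by rewrite mulrACA i2 mulN1r expr2.
have ib : - 'i * b = - (kappa%:C ^+ 2 + v%:C).
  by rewrite mulrA mulrNN i2 mulN1r rmorphD rmorphXn.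
transitivity (a * a * s * s'); first by ring.
transitivity ((- 'i * b) * s * s' + v%:C * (s * s')); last by ring.
by rewrite aa ib; ring.
Qed.

(** The recursion trades two derivatives in x for at most one in t, so it never
    leaves the range of orders up to p and ends at entries with at most one
    derivative in x. *)
Lemma jet_unique (p : nat) v (X Y : nat * nat -> C) :
  (forall jx jt, (jx.+2 + jt <= p)%N ->
    X (jx.+2, jt) = - 'i * X (jx, jt.+1) + v%:C * X (jx, jt)) ->
  (forall jx jt, (jx.+2 + jt <= p)%N ->
    Y (jx.+2, jt) = - 'i * Y (jx, jt.+1) + v%:C * Y (jx, jt)) ->
  (forall b : bool, forall jt, (b + jt <= p)%N -> X (b : nat, jt) = Y (b : nat, jt)) ->
  forall j, (mi_order j <= p)%N -> X j = Y j.
Proof.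
move=> hX hY XY [jx jt]; rewrite /mi_order /=.
elim/ltn_ind: jx jt => -[|[|jx]] IH jt jp.
- exact: (XY false).
- exact: (XY true).
- rewrite hX// hY// !IH//.
  + by rewrite (leq_trans _ jp)// leq_add2r; lia.
  + by rewrite (leq_trans _ jp)// addnS; lia.
Qed.

(** The multi-indices with first entry 0 or 1, ordered so that the symbol of
    the m-th one has degree m in the wave number. *)
Definition chain (m : nat) : nat * nat := (odd m : nat, m./2).

Lemma chain_order p m : (m < 2 * p + 1)%N -> (mi_order (chain m) <= p)%N.
Proof. by rewrite /mi_order /= => mp; have := odd_double_half m; lia. Qed.

Lemma chain_bool (b : bool) n : chain (b + n.*2) = (b : nat, n).
Proof. by rewrite /chain oddD odd_double addbF oddb half_bit_double. Qed.

(** The symbol along the chain as a polynomial in the wave number. *)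
Definition symbol_poly v (m : nat) : {poly C} :=
  ('i ^+ odd m * (- 'i) ^+ m./2) *: ('X^(odd m) * ('X^2 + (v%:C)%:P) ^+ m./2).

Lemma symbol_polyE v m kappa : (symbol_poly v m).[kappa%:C] = symbol v kappa (chain m).
Proof.
rewrite /symbol_poly /symbol /= !hornerE !exprMn rmorphD rmorphXn /=.
by rewrite -mulrA mulrACA.
Qed.

Lemma size_symbol_poly v m : size (symbol_poly v m) = m.+1.
Proof.
have i0 : 'i != 0 :> C by rewrite eq_complex /= oner_eq0 andbF.
rewrite size_scale; last by rewrite mulf_neq0// expf_neq0// oppr_eq0.
have q0 : 'X^2 + (v%:C)%:P != 0 :> {poly C}.
  by rewrite -size_poly_gt0 size_XnaddC.
rewrite size_monicM ?monicXn ?expf_neq0// size_polyXn addSn /=.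
have := size_exp ('X^2 + (v%:C)%:P : {poly C}) m./2.
have : (0 < size (('X^2 + (v%:C)%:P : {poly C}) ^+ m./2)%R)%N.
  by rewrite size_poly_gt0 expf_neq0.
rewrite size_XnaddC//; case: (size _) => //= n _ ->.
by rewrite addnS mul2n odd_double_half.
Qed.

Section Matrix.
Variables (p : nat) (k : 'I_(2 * p + 1) -> R) (v : R).
Hypothesis hk : injective k.

Definition symbol_mx : 'M[C]_(2 * p + 1) :=
  \matrix_(m, l) symbol v (k l) (chain m).

(** Up to a triangular change of basis this is the Vandermonde matrix of the
    wave numbers. *)
Lemma symbol_mx_unit : symbol_mx \in unitmx.
Proof.
pose T : 'M[C]_(2 * p + 1) := \matrix_(m, i) (symbol_poly v m)`_i.
pose a : 'rV[C]_(2 * p + 1) := \row_l (k l)%:C.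
have -> : symbol_mx = T *m Vandermonde (2 * p + 1) a.
  apply/matrixP => m l; rewrite !mxE -symbol_polyE.
  rewrite (@horner_coef_wide _ (2 * p + 1)) ?size_symbol_poly//.
  by apply: eq_bigr => i _; rewrite !mxE.
rewrite unitmx_mul !unitmxE det_trig; last first.
  apply/is_trig_mxP => i i' ii'; rewrite mxE nth_default//.
  by rewrite size_symbol_poly.
rewrite det_Vandermonde !unitfE; apply/andP; split.
  apply/prodf_neq0 => i _; rewrite mxE.
  have := lead_coef_eq0 (symbol_poly v i); rewrite lead_coefE size_symbol_poly /=.
  by move=> ->; rewrite -size_poly_gt0 size_symbol_poly.
apply/prodf_neq0 => i _; apply/prodf_neq0 => i' ii'; rewrite !mxE subr_eq0.
apply: contraTneq ii' => /complexI /hk ->; by rewrite ltnn.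
Qed.

End Matrix.
End PlaneWaves.

(** * Estimates *)

Section CauchySchwarz.
Context d (T : measurableType d) (R : realType).
Variables (mu : {measure set T -> \bar R}) (D : set T).
Hypotheses (mD : measurable D) (D0 : 0 < fine (mu D)) (finD : (mu D < +oo)%E).
Implicit Types f : T -> R[i].

Lemma inL2_measurable_normc f : inL2 mu D f ->
  measurable_fun D (fun q => (Normc.normc (f q))%:E).
Proof. by move=> [m1 m2 _]; apply/measurable_EFinP; exact: measurable_normc. Qed.

Lemma normc_ge0 (z : R[i]) : 0 <= Normc.normc z.
Proof. by case: z => a b; exact: sqrtr_ge0. Qed.

Lemma inL2_integrable_normc f : inL2 mu D f ->
  mu.-integrable D (fun q => (Normc.normc (f q))%:E).
Proof.
move=> Lf; have [h1 h2] := inL2_inL1 mD finD Lf.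
apply: (le_integrable mD _ _ (integrableD mD (integrable_abse h1) (integrable_abse h2))).
  exact: inL2_measurable_normc.
move=> q _; rewrite /= lee_fin ger0_norm ?normc_ge0// [leRHS]ger0_norm//.
rewrite -(@ler_pXn2r _ 2) ?nnegrE ?normc_ge0 ?addr_ge0//.
rewrite sqr_normc sqrrD !real_normK ?num_real// lerD2r lerDl.
by rewrite mulrn_wge0// mulr_ge0.
Qed.

Lemma integral_normc_le f : inL2 mu D f ->
  (\int[mu]_(q in D) (Normc.normc (f q))%:E <=
   (Num.sqrt (fine (mu D)) * Num.sqrt (fine (L2normsq mu D f)))%:E)%E.
Proof.
move=> Lf; have isqr := inL2_integrable_sqr Lf.
have inorm := inL2_integrable_normc Lf.
rewrite -(fineK (integrable_fin_num mD inorm)) lee_fin.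
rewrite -/(Rintegral mu D (fun q => Normc.normc (f q))).
set J := Rintegral _ _ _; set A := fine (mu D).
have -> : fine (L2normsq mu D f) = Rintegral mu D (fun q => Normc.normc (f q) ^+ 2) by [].
set N := Rintegral _ _ _.
have J0 : 0 <= J by apply: Rintegral_ge0 => q _; exact: normc_ge0.
have N0 : 0 <= N by apply: Rintegral_ge0 => q _; exact: sqr_ge0.
have icst (x : R) : mu.-integrable D (EFin \o cst x).
  apply/integrableP; split; first exact/measurable_EFinP.
  rewrite (eq_integral (cst `|x|%:E))//= integral_cst//.
  by rewrite -(@fineK _ (mu D)) ?ge0_fin_numE// -EFinM ltry.
have iZ (x : R) : mu.-integrable D (EFin \o (fun q => x * Normc.normc (f q))).
  by apply: (eq_integrable mD _ (fun q => x%:E * (Normc.normc (f q))%:E)%E) => //;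
    exact: integrableZl.
(* the integral of (l - |f|)^2 is nonnegative; the choice l = J / A below, the
   mean of |f|, is the optimal one *)
have key (l : R) : 2 * l * J <= l ^+ 2 * A + N.
  rewrite -(Rintegral_cst mu mD (l ^+ 2)) -RintegralD//; last exact: icst.
  rewrite -RintegralZl//; apply: le_Rintegral => //.
    by apply: (integrableD mD (icst (l ^+ 2)) isqr).
  move=> q _; rewrite -subr_ge0.
  rewrite (_ : _ - _ = (l - Normc.normc (f q)) ^+ 2) ?sqr_ge0//=; ring.
have := key (J / A); rewrite -sqrtrM ?(ltW D0)// => kJ.
rewrite -(ger0_norm J0) -sqrtr_sqr ler_wsqrtr//.
have -> : J ^+ 2 = A * (J ^+ 2 / A) by field; rewrite gt_eqF.
rewrite ler_pM2l// -(lerD2l (J ^+ 2 / A)); apply: le_trans (le_trans kJ _).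
  by rewrite le_eqVlt; apply/orP; left; apply/eqP; field; rewrite gt_eqF.
by rewrite le_eqVlt; apply/orP; left; apply/eqP; field; rewrite gt_eqF.
Qed.

Lemma inL1S (E : set T) f : measurable E -> E `<=` D -> inL1 mu D f -> inL1 mu E f.
Proof. by move=> mE ED [f1 f2]; split; exact: (integrableS mD mE ED). Qed.

Lemma inL1_sum (I : Type) (s : seq I) (F : I -> T -> R[i]) :
  (forall i, inL1 mu D (F i)) -> inL1 mu D (fun q => \sum_(i <- s) F i q).
Proof.
move=> LF; elim: s => [|i s IH].
  by under [X in inL1 _ _ X]eq_fun do rewrite big_nil; split; exact: integrable0.
by under [X in inL1 _ _ X]eq_fun do rewrite big_cons; exact: inL1D.
Qed.

Lemma normc_sum (I : finType) (F : I -> R[i]) :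
  Normc.normc (\sum_i F i) <= \sum_i Normc.normc (F i).
Proof.
elim/big_ind2 : _ => [|x x' y y' hx hy|//]; first by rewrite Normc.normc0.
by apply: le_trans (le_normcD _ _) _; exact: lerD.
Qed.

Lemma integral_combination_le (E : set T) (I J : finType) (N : I -> J -> R[i])
    (a : I -> T -> R[i]) (W : J -> T -> R[i]) (H : R) :
  measurable E -> E `<=` D -> (forall l, inL1 mu E (a l)) ->
  (forall m, inL2 mu D (W m)) ->
  (forall m, Num.sqrt (fine (L2normsq mu D (W m))) <= H) ->
  (forall l q, E q -> Normc.normc (a l q) = Normc.normc (\sum_m N l m * W m q)) ->
  (\int[mu]_(q in E) (\sum_l Normc.normc (a l q))%:E <=
    ((\sum_l \sum_m Normc.normc (N l m)) * (Num.sqrt (fine (mu D)) * H))%:E)%E.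
Proof.
move=> mE ED La LW WH aW.
pose c m := \sum_l Normc.normc (N l m).
have c0 m : 0 <= c m by apply: sumr_ge0 => l _; exact: normc_ge0.
have mh m : measurable_fun D (fun q => (c m)%:E * (Normc.normc (W m q))%:E)%E.
  by apply: measurable_funeM; exact: inL2_measurable_normc.
have h0 m q : (0 <= (c m)%:E * (Normc.normc (W m q))%:E)%E.
  by rewrite mule_ge0// lee_fin// normc_ge0.
apply: (@le_trans _ _
  (\int[mu]_(q in D) (\sum_m (c m)%:E * (Normc.normc (W m q))%:E))%E).
  apply: (@le_trans _ _
    (\int[mu]_(q in E) (\sum_m (c m)%:E * (Normc.normc (W m q))%:E))%E); last first.
    apply: ge0_subset_integral => //; first exact: emeasurable_sum.
    by move=> q _; exact: sume_ge0.
  apply: ge0_le_integral => //.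
  - by move=> q _; rewrite lee_fin sumr_ge0// => l _; exact: normc_ge0.
  - apply/measurable_EFinP; apply: measurable_sum => l.
    have [l1 l2] := La l; apply: measurable_normc; apply/measurable_EFinP.
      exact: (measurable_int _ l1).
    exact: (measurable_int _ l2).
  - by apply: (measurable_funS mD ED); exact: emeasurable_sum.
  - move=> q Eq; under [leRHS]eq_bigr do rewrite -EFinM.
    rewrite [leRHS]sumEFin lee_fin.
    apply: (@le_trans _ _ (\sum_l \sum_m Normc.normc (N l m) * Normc.normc (W m q))).
      apply: ler_sum => l _; rewrite aW//; apply: le_trans (normc_sum _) _.
      by apply: ler_sum => m _; rewrite Normc.normcM.
    by rewrite exchange_big/=; apply: ler_sum => m _; rewrite /c mulr_suml.
rewrite ge0_integral_sum//.
rewrite exchange_big/= mulr_suml -sumEFin; apply: lee_sum => m _.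
rewrite -/(c m) ge0_integralZl_EFin//; last 2 first.
- by move=> q _; rewrite lee_fin normc_ge0.
- exact: inL2_measurable_normc.
rewrite EFinM lee_wpmul2l ?lee_fin//.
apply: le_trans (integral_normc_le (LW m)) _.
by rewrite lee_fin ler_wpM2l ?sqrtr_ge0.
Qed.

End CauchySchwarz.

(** * Sobolev norms and division by plane waves *)

Section Sobolev.
Variable R : realType.
Implicit Types (D : set (R * R)) (f : R * R -> R[i]) (j : nat * nat).

Lemma wderivP m D f j : inH m D f -> (mi_order j <= m)%N ->
  inL2 (leb2 R) D (wderiv D j f) /\ is_wderiv D j f (wderiv D j f).
Proof. by move=> [_ Hf] /Hf; exact: xgetPex. Qed.

Lemma wderiv_le_Hnorm m D f j : (mi_order j <= m)%N ->
  Num.sqrt (fine (L2normsq (leb2 R) D (wderiv D j f))) <= Hnorm m D f.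
Proof.
case: j => jx jt; rewrite /mi_order /= => jm; apply: ler_wsqrtr.
have F0 g : 0 <= fine (L2normsq (leb2 R) D g).
  by apply: fine_ge0; apply: integral_ge0 => q _; rewrite lee_fin sqr_ge0.
have lex : (jx < m.+1)%N by lia.
have ltt : (jt < m.+1)%N by lia.
rewrite (bigD1 (Ordinal lex))//= (bigD1 (Ordinal ltt))//= -addrA lerDl.
by rewrite addr_ge0// sumr_ge0// => i _; rewrite sumr_ge0.
Qed.

Lemma measurable_disc (c : R * R) (r : R) :
  measurable (disc c r : set (measurableTypeR R * measurableTypeR R)).
Proof.
pose f (q : measurableTypeR R * measurableTypeR R) : R :=
  (q.1 - c.1) ^+ 2 + (q.2 - c.2) ^+ 2.
have mf : measurable_fun setT f.
  apply: measurable_funD; apply: measurable_funX; apply: measurable_funB;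
    [exact: measurable_fst|exact: measurable_cst|exact: measurable_snd|
     exact: measurable_cst].
rewrite (_ : disc c r = f @^-1` `]-oo, r ^+ 2[%classic); last first.
  by apply/seteqP; split=> q; rewrite /disc /= in_itv.
by rewrite -[X in measurable X]setTI; apply: mf => //; exact: measurable_itv.
Qed.

(** The inverse of a plane wave is its conjugate, with bounded real and
    imaginary parts. *)
Lemma inL1_div_plane_wave (v kappa : R)
    (D : set (measurableTypeR R * measurableTypeR R)) f :
  measurable D -> inL1 (leb2 R) D f ->
  inL1 (leb2 R) D (fun q => (plane_wave v kappa q)^-1 * f q).
Proof.
move=> mD Lf.
pose th (q : measurableTypeR R * measurableTypeR R) : R :=
  kappa * q.1 - (kappa ^+ 2 + v) * q.2.
have mth : measurable_fun D th.
  by apply/measurable_funTS; apply: measurable_funB;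
    exact: measurable_funM.
have mcos : measurable_fun D (cos \o th).
  exact: (measurableT_comp (continuous_measurable_fun (@continuous_cos R))).
have msin : measurable_fun D (sin \o th).
  exact: (measurableT_comp (continuous_measurable_fun (@continuous_sin R))).
have -> : (fun q => (plane_wave v kappa q)^-1 * f q) =
    (fun q => f q * ((cos \o th) q)%:C%C + - 'i%C * (f q * ((sin \o th) q)%:C%C)).
  apply/funext => q; rewrite plane_waveE -/(th q) /=.
  transitivity (((cos (th q))%:C%C - 'i%C * (sin (th q))%:C%C) * f q); last by ring.
  congr (_ * _); apply: (mulfI (_ : (cos (th q) +i* sin (th q))%C != 0)).
    by rewrite -plane_waveE plane_wave_neq0.
  rewrite divff; last by rewrite -plane_waveE plane_wave_neq0.
  apply/eqP; rewrite eq_complex /= -[X in X == _](cos2Dsin2 (th q)).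
  by apply/andP; split; apply/eqP; ring.
apply: (inL1D mD).
  by apply: (inL1_mulr mD) => //; exists 1 => q; exact: cos_max.
apply: (inL1Z mD); apply: (inL1_mulr mD) => //; exists 1 => q.
exact: sin_max.
Qed.

End Sobolev.

(** * The representation of the jet *)

Section Jet.
Variables (R : realType) (p : nat) (x0 x1 t0 t1 v : R).
Hypotheses (x01 : x0 < x1) (t01 : t0 < t1).
Let K : set (R * R) := `]x0, x1[%classic `*` `]t0, t1[%classic.

Lemma jet_schroedinger (V : R * R -> R) psi :
  (forall q, K q -> V q = v) -> trefftz `]x0, x1[%classic `]t0, t1[%classic V psi ->
  inH p.+1 K psi ->
  {ae leb2 R, forall q, forall jx jt, K q -> (jx.+2 + jt <= p)%N ->
    wderiv K (jx.+2, jt) psi q =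
    - 'i%C * wderiv K (jx, jt.+1) psi q + v%:C%C * wderiv K (jx, jt) psi q}.
Proof.
move=> Vv Tpsi Hpsi.
have Lpsi := inL2_K_inL1 x01 t01 Hpsi.1.
pose mu2 : {measure set (measurableTypeR R * measurableTypeR R) -> \bar R} := leb2 R.
apply: (ae_foralln (mu := mu2)) => jx; apply: (ae_foralln (mu := mu2)) => jt.
have [jp|jp] := leqP (jx.+2 + jt)%N p; last by apply: aeW => q _; lia.
have W j : (mi_order j <= p)%N -> inL1 (leb2 R) K (wderiv K j psi) /\
    is_wderiv K j psi (wderiv K j psi).
  move=> jp'; have [|h ?] := wderivP Hpsi (_ : (mi_order j <= p.+1)%N).
    exact: leqW.
  by split => //; exact: (inL2_K_inL1 x01 t01).
have [Lxx wxx] := W (jx.+2, jt) jp.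
have [|Lt wt] := W (jx, jt.+1); first by rewrite /mi_order /=; lia.
have [|L w] := W (jx, jt); first by rewrite /mi_order /=; lia.
have := wderiv_schroedinger x01 t01 Vv Tpsi Lpsi Lxx Lt L wxx wt w.
by apply: filterS => q h Kq _; exact: h.
Qed.

End Jet.

Theorem proposition4p8 (R : realType) (p : nat) (hp : (1 <= p)%N)
    (k : 'I_(2 * p + 1) -> R) (hk : injective k) (v : R) :
  exists Cstar : R, 0 < Cstar /\
  forall (x0 x1 t0 t1 : R) (hx : x0 < x1) (ht : t0 < t1)
    (V : R * R -> R) (c : R * R) (r : R) (hr : 0 < r),
  let Kx : set R := (`]x0, x1[%classic) in
  let In : set R := (`]t0, t1[%classic) in
  let K : set (R * R) := Kx `*` In in
  let B : set (R * R) := disc c r in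
  (forall q : R * R, K q -> V q = v) ->
  B `<=` K ->
  star_shaped_wrt K B ->
  forall psi : R * R -> R[i],
  trefftz Kx In V psi -> inH p.+1 K psi ->
  exists a : 'I_(2 * p + 1) -> R * R -> R[i],
    [/\ forall l, inL1 (leb2 R) B (a l),
        {ae leb2 R, forall q, B q -> forall j : nat * nat, (mi_order j <= p)%N ->
          wderiv K j psi q = \sum_l a l q * Dcl j (plane_wave v (k l)) q} &
        (\int[leb2 R]_(q in B) (\sum_l Normc.normc (a l q))%:E <=
           (Cstar * Num.sqrt (fine (leb2 R K)) * Hnorm p.+1 K psi)%:E)%E].
Proof.
set n := (2 * p + 1)%N in k hk *.
pose N := invmx (symbol_mx k v).
have N0 : 0 <= \sum_l \sum_m Normc.normc (N l m).
  by apply: sumr_ge0 => l _; apply: sumr_ge0 => m _; exact: normc_ge0.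
exists (\sum_l \sum_m Normc.normc (N l m) + 1); split; first by rewrite ltr_wpDl.
move=> x0 x1 t0 t1 x01 t01 V c r r0 Kx In K B Vv BK _ psi Tpsi Hpsi.
pose W (m : 'I_n) := wderiv K (chain m) psi.
have mK : measurable (K : set (measurableTypeR R * measurableTypeR R)).
  exact: measurable_box.
have mB := measurable_disc c r.
have KE : leb2 R K = ((x1 - x0) * (t1 - t0))%:E by exact: leb2_boxE.
have K0 : 0 < fine (leb2 R K) by rewrite KE mulr_gt0 ?subr_gt0.
have Kfin : (leb2 R K < +oo)%E by rewrite KE ltry.
have chain_le (m : 'I_n) : (mi_order (chain m) <= p.+1)%N.
  by apply: leqW; exact: chain_order.
have LW m : inL2 (leb2 R) K (W m) by have [] := wderivP Hpsi (chain_le m).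
(* dividing by phi_l removes the factor that makes the matrix at q differ from
   the constant matrix of symbols *)
pose a l q := (plane_wave v (k l) q)^-1 * \sum_m N l m * W m q.
have La l : inL1 (leb2 R) B (a l).
  apply: inL1_div_plane_wave => //; apply: (inL1_sum mB) => m.
  apply: (inL1Z mB); apply: (inL1S mK mB BK).
  exact: (inL2_inL1 mK Kfin (LW m)).
exists a; split => //.
- have := jet_schroedinger x01 t01 Vv Tpsi Hpsi.
  apply: filterS => q jet Bq j jp; have Kq := BK q Bq.
  pose b l := \sum_m N l m * W m q.
  transitivity (\sum_l b l * symbol v (k l) j); last first.
    apply: eq_bigr => l _; rewrite Dcl_plane_wave /a -/(b l).
    by field; exact: plane_wave_neq0.
  apply: (@jet_unique R p v (fun j => wderiv K j psi q)
    (fun j => \sum_l b l * symbol v (k l) j)) => // [jx jt jp'|jx jt jp'|d jt jp'].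
  + exact: jet.
  + rewrite !mulr_sumr -big_split; apply: eq_bigr => l _.
    by rewrite symbol_rec /=; ring.
  + have mlt : (d + jt.*2 < n)%N by rewrite /n; case: d jp' => /=; lia.
    pose cv : 'cV[R[i]]_n := \col_m W m q.
    have := congr1 (fun A : 'cV[R[i]]_n => A (Ordinal mlt) 0)
      (mulKVmx (symbol_mx_unit v hk) cv).
    rewrite /cv !mxE /W /= chain_bool => <-; apply: eq_bigr => l _.
    rewrite !mxE /= chain_bool mulrC /b; congr (_ * _); apply: eq_bigr => m _.
    by rewrite mxE.
- apply: (le_trans (integral_combination_le mK K0 Kfin mB BK La LW _ _)).
  + by move=> m; exact: wderiv_le_Hnorm (chain_le m).
  + move=> l q _; rewrite /a Normc.normcM Normc.normcV normc_plane_wave.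
    by rewrite invr1 mul1r.
  + rewrite lee_fin mulrA ler_wpM2r ?sqrtr_ge0// ler_wpM2r ?sqrtr_ge0//.
    by rewrite lerDl.
Qed.
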